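(* Suppose the differentiable function $f:\mathbb{R}^d\to\mathbb{R}$ is $L$-gradient Lipschitz, i.e. $\|\nabla f(\mathbf{x}_1)-\nabla f(\mathbf{x}_2)\|\le L\|\mathbf{x}_1-\mathbf{x}_2\|$ for all $\mathbf{x}_1,\mathbf{x}_2$, and is bounded below by $f^\star$. If the Stochastic Two-Point search (S2P) algorithm (defined in the context) is run with step size strategy Option 1 or Option 2, then the algorithm returns in expectation an $\epsilon$-first-order stationary point in $\mathcal{O}\left(\frac{d}{\epsilon^2}\right)$ function evaluations. Specifically, the required $K$ is: Option 1 (stationary step size $\alpha_k=\alpha_0/\sqrt{Kd}$): $$K\ \ge\ \frac{2d}{\epsilon^2}\left(\frac{f(\mathbf{x}_0)-f^\star}{\alpha_0}+\frac{L\alpha_0}{2}\right)^2 ;$$ Option 2 (dynamic step size $\alpha_k=\frac{|\gamma_k|}{Ld}$ with $|\gamma_k|=\frac{|f(\mathbf{x}_k+\rho\mathbf{s}_k)-f(\mathbf{x}_k-\rho\mathbf{s}_k)|}{2\rho}$): $$K\ \ge\ \frac{4Ld\,(f(\mathbf{x}_0)-f^\star)}{\epsilon^2-\frac{\rho^2}{2}} .$$ Here $\alpha_0>0$ for Option 1; for Option 2, the scalar $\rho=\rho_k$ used in each iteration $k$ satisfies $\rho_k\in\left(0,\frac{\sqrt2\,\|\nabla f(\mathbf{x}_k)\|}{Ld}\right]$. Generally, $\rho$ can be set to a small value, e.g. $\rho=\frac{\sqrt2\,\epsilon}{Ld}$.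
   Context: $\|\cdot\|$ is the Euclidean norm, and $f^\star$ denotes the global minimum of $f$. A point $\mathbf{x}$ is an $\epsilon$-first-order stationary point of $f$ if $\|\nabla f(\mathbf{x})\|\le\epsilon$. $\mathcal{O}(\cdot)$ hides constants. S2P algorithm: starting from $\mathbf{x}_0\in\mathbb{R}^d$, for $k=0,\dots,K$: draw a random vector $\mathbf{s}_k\in\{+1,-1\}^d$ from the Rademacher distribution (each coordinate is $+1$ or $-1$ with equal chances); compute the step size $\alpha_k$ according to the chosen option; and let $\mathbf{x}_{k+1}$ be whichever of the two points $\mathbf{x}_k+\alpha_k\mathbf{s}_k$ and $\mathbf{x}_k-\alpha_k\mathbf{s}_k$ has the smaller value of $f$. $K$ is the number of iterations (epochs). *)

(* Defs.v *)
From mathcomp Require Import all_boot all_order all_algebra.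
From mathcomp Require Import all_classical all_reals all_analysis.

Set Implicit Arguments.
Unset Strict Implicit.
Unset Printing Implicit Defensive.

Import Order.TTheory GRing.Theory Num.Theory.
Import numFieldNormedType.Exports.

Local Open Scope classical_set_scope.
Local Open Scope ring_scope.

(* The library norm `|x| on 'rV[R]_d is the sup norm, hence this definition. *)
Definition enorm (R : realType) (d : nat) (x : 'rV[R]_d) : R :=
  Num.sqrt (\sum_(i < d) x 0 i ^+ 2).

Definition grad (R : realType) (d : nat) (f : 'rV[R]_d -> R) (x : 'rV[R]_d) :
    'rV[R]_d :=
  \row_(i < d) 'D_(delta_mx 0 i) f x.

Definition gradient_lipschitz (R : realType) (d : nat) (L : R)
    (f : 'rV[R]_d -> R) : Prop :=
  forall x1 x2, enorm (grad f x1 - grad f x2) <= L * enorm (x1 - x2).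

Definition objective (R : realType) (d : nat) (L fstar : R)
    (f : 'rV[R]_d -> R) : Prop :=
  [/\ forall x, differentiable f x,
      gradient_lipschitz L f
    & forall x, fstar <= f x].

Definition rademacher (disp : measure_display) (T : measurableType disp)
    (R : realType) (P : probability T R) (X : {RV P >-> R}) : Prop :=
  [/\ forall t, X t = 1 \/ X t = -1,
      P (X @^-1` [set 1]) = (2^-1)%:E
    & P (X @^-1` [set -1]) = (2^-1)%:E].

Definition mutually_independent (disp : measure_display)
    (T : measurableType disp) (R : realType) (P : probability T R)
    (I : eqType) (X : I -> {RV P >-> R}) : Prop :=
  forall (J : seq I) (B : I -> set R),
    uniq J -> (forall i, measurable (B i)) ->
    P (\bigcap_(i in [set` J]) (X i @^-1` B i)) =
    (\prod_(i <- J) P (X i @^-1` B i))%E.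

(* [e (k, i)] is the i-th coordinate of the k-th draw. *)
Definition iid_rademacher (disp : measure_display) (T : measurableType disp)
    (R : realType) (P : probability T R) (d : nat)
    (e : nat * 'I_d -> {RV P >-> R}) : Prop :=
  (forall ki, rademacher (e ki)) /\ mutually_independent e.

Definition draw (disp : measure_display) (T : measurableType disp)
    (R : realType) (P : probability T R) (d : nat)
    (e : nat * 'I_d -> {RV P >-> R}) (k : nat) (t : T) : 'rV[R]_d :=
  \row_(i < d) e (k, i) t.

(* For k < K, y_k is a function of the earlier draws s_0, ..., s_(k-1) only. *)
Definition nonanticipating (T A V : Type) (K : nat) (s : nat -> T -> A)
    (y : nat -> T -> V) : Prop :=
  forall (k : nat) (t t' : T), (k < K)%N ->
    (forall j, (j < k)%N -> s j t = s j t') -> y k t = y k t'.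

(* Relational, because the two candidate points may tie. *)
Definition s2p_step (R : realType) (d : nat) (f : 'rV[R]_d -> R)
    (alpha : R) (s x y : 'rV[R]_d) : Prop :=
  [/\ y = x + alpha *: s \/ y = x - alpha *: s,
      f y <= f (x + alpha *: s)
    & f y <= f (x - alpha *: s)].

(* The iterations k = 0, ..., K-1. Ties are broken by any rule that does not
   look at future draws. *)
Definition s2p_run (R : realType) (d : nat) (T : Type) (f : 'rV[R]_d -> R)
    (x0 : 'rV[R]_d) (K : nat) (s : nat -> T -> 'rV[R]_d)
    (alpha : nat -> T -> R) (x : nat -> T -> 'rV[R]_d) : Prop :=
  [/\ nonanticipating K s x,
      forall t, x 0%N t = x0
    & forall k t, (k < K)%N ->
        s2p_step f (alpha k t) (s k t) (x k t) (x k.+1 t)].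

Definition option1_run (R : realType) (d : nat) (T : Type)
    (f : 'rV[R]_d -> R) (x0 : 'rV[R]_d) (alpha0 : R) (K : nat)
    (s : nat -> T -> 'rV[R]_d) (x : nat -> T -> 'rV[R]_d) : Prop :=
  s2p_run f x0 K s (fun _ _ => alpha0 / Num.sqrt (K%:R * d%:R)) x.

Definition s2p_gamma (R : realType) (d : nat) (f : 'rV[R]_d -> R) (rho : R)
    (s x : 'rV[R]_d) : R :=
  (f (x + rho *: s) - f (x - rho *: s)) / (2 * rho).

(* rho_k may be chosen adaptively, but before s_k is drawn. *)
Definition option2_run (R : realType) (d : nat) (T : Type)
    (f : 'rV[R]_d -> R) (x0 : 'rV[R]_d) (L : R) (K : nat)
    (s : nat -> T -> 'rV[R]_d) (rho : nat -> T -> R)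
    (x : nat -> T -> 'rV[R]_d) : Prop :=
  [/\ nonanticipating K s rho,
      forall k t, (k < K)%N ->
        0 < rho k t
        /\ rho k t <= Num.sqrt 2 * enorm (grad f (x k t)) / (L * d%:R)
    & s2p_run f x0 K s
        (fun k t => `|s2p_gamma f (rho k t) (s k t) (x k t)| / (L * d%:R)) x].

(* The expected gradient norm at an iterate drawn uniformly from
   x_0, ..., x_(K-1) is at most eps; in particular E ||grad f(x_k)|| <= eps for
   some k < K. *)
Definition returns_stationary (disp : measure_display)
    (T : measurableType disp) (R : realType) (P : probability T R) (d : nat)
    (f : 'rV[R]_d -> R) (x : nat -> T -> 'rV[R]_d) (K : nat) (eps : R) : Prop :=
  ((K%:R^-1)%:E * \sum_(k < K) 'E_P[fun t => enorm (grad f (x k t))]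
     <= eps%:E)%E.

(* f is evaluated at x_k +- alpha_k s_k in each iteration, and with Option 2
   also at x_k +- rho_k s_k. *)
Definition option1_evaluations (K : nat) : nat := (2 * K)%N.
Definition option2_evaluations (K : nat) : nat := (4 * K)%N.

(* Main.v *)
Require Import Defs.
From mathcomp Require Import all_boot all_order all_algebra.
From mathcomp Require Import all_classical all_reals all_analysis.
From mathcomp Require Import measurable_realfun ring lra.

(* Since s_k is independent of x_k, each step decreases E f by a multiple of
   E |<grad f(x_k), s_k>| (Option 1), respectively of E <grad f(x_k), s_k>^2
   (Option 2), up to second-order terms controlled by the Lipschitz gradient.
   These means are bounded below by E ||grad f(x_k)|| / sqrt 2, Khintchine's
   inequality with its best constant, and equal to E ||grad f(x_k)||^2.  The
   decreases telescope to at most f(x_0) - fstar.  As the iterates depend on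
   finitely many signs only, every expectation is a uniform average over the
   patterns in {+1,-1}^(K d). *)

Set Implicit Arguments.
Unset Strict Implicit.
Unset Printing Implicit Defensive.

Import Order.TTheory GRing.Theory Num.Theory.
Import numFieldNormedType.Exports.

Local Open Scope classical_set_scope.
Local Open Scope ring_scope.

(** * Khintchine's inequality *)

(** Walsh character of the cube. A Boolean encodes a sign, [true] standing for -1, so sign patterns
    form a finite type and multiply by exclusive or. *)
Definition walsh (R : nzRingType) (I : finType) (S : {set I})
    (x : {ffun I -> bool}) : R :=
  \prod_(i in S) (-1) ^+ x i.

Definition walsh_coef (R : nzRingType) (I : finType) (h : {ffun I -> bool} -> R)
    (S : {set I}) : R :=
  \sum_x h x * walsh R S x.

Definition flips (I : finType) (m x : {ffun I -> bool}) : {ffun I -> bool} :=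
  [ffun i => x i (+) m i].

Lemma flipsK (I : finType) (m : {ffun I -> bool}) : involutive (flips m).
Proof. by move=> x; apply/ffunP => i; rewrite !ffunE addbK. Qed.

Lemma sum_flips (V : nmodType) (I : finType) (m : {ffun I -> bool})
    (h : {ffun I -> bool} -> V) :
  \sum_x h (flips m x) = \sum_x h x.
Proof. by rewrite [RHS](reindex_inj (inv_inj (flipsK m))). Qed.

Lemma card_cube (I : finType) : #|{: {ffun I -> bool}}| = (2 ^ #|I|)%N.
Proof. by rewrite card_ffun card_bool. Qed.

Lemma walsh_flips (R : comNzRingType) (I : finType) (S : {set I})
    (m x : {ffun I -> bool}) :
  walsh R S (flips m x) = walsh R S m * walsh R S x.
Proof.
rewrite /walsh -big_split; apply: eq_bigr => i _.
by rewrite ffunE signr_addb mulrC.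
Qed.

(** The sum over [S] expands the product over i of 1 + x_i y_i for the encoded signs; a coordinate
    where they differ contributes a zero factor. *)
Lemma sum_walsh (R : comNzRingType) (I : finType) (x y : {ffun I -> bool}) :
  \sum_(S : {set I}) walsh R S x * walsh R S y = (x == y)%:R * 2 ^+ #|I| :> R.
Proof.
transitivity (\prod_i ((-1) ^+ x i * (-1) ^+ y i + 1) : R).
  rewrite bigA_distr; apply: eq_big => [S|S _]; first by rewrite inE.
  by rewrite /walsh -big_split -big_mkcond.
have [<-|/eqP/ffunP neq_xy] := eqVneq x y.
  rewrite mul1r -[RHS]prodr_const; apply: eq_bigr => i _.
  by rewrite -expr2 sqrr_sign.
rewrite mul0r; have [i neq_i] : exists i, x i != y i.
  apply/existsP; rewrite -negb_forall; apply/negP => /forallP exy.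
  by apply: neq_xy => i; apply/eqP.
rewrite (bigD1 i) //= -signr_addb; move: neq_i; case: (x i); case: (y i) => //.
all: by rewrite /= expr1 addNr mul0r.
Qed.

Lemma parseval (R : comNzRingType) (I : finType)
    (h g : {ffun I -> bool} -> R) :
  \sum_(S : {set I}) walsh_coef h S * walsh_coef g S
    = 2 ^+ #|I| * \sum_x h x * g x.
Proof.
transitivity (\sum_x \sum_y h x * g y *
    \sum_(S : {set I}) walsh R S x * walsh R S y).
  transitivity (\sum_(S : {set I}) \sum_x \sum_y
      h x * g y * (walsh R S x * walsh R S y)).
    apply: eq_bigr => S _; rewrite /walsh_coef big_distrlr /=.
    by apply: eq_bigr => x _; apply: eq_bigr => y _; rewrite mulrACA.
  rewrite exchange_big; apply: eq_bigr => x _ /=.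
  rewrite exchange_big; apply: eq_bigr => y _ /=.
  by rewrite mulr_sumr.
rewrite mulr_sumr; apply: eq_bigr => x _;
  rewrite (bigD1 x) //= [X in _ + X]big1 => [|y].
  by rewrite sum_walsh eqxx mul1r addr0 mulrC.
by rewrite sum_walsh eq_sym => /negPf ->; rewrite mul0r mulr0.
Qed.

Lemma walsh_coef_flips (R : comNzRingType) (I : finType)
    (h : {ffun I -> bool} -> R) (m : {ffun I -> bool}) (S : {set I}) :
  walsh_coef (h \o flips m) S = walsh R S m * walsh_coef h S.
Proof.
rewrite /walsh_coef -(sum_flips m) mulr_sumr; apply: eq_bigr => x _ /=.
by rewrite walsh_flips flipsK mulrCA.
Qed.

Definition rsum (R : nzRingType) (I : finType) (a : I -> R)
    (x : {ffun I -> bool}) : R :=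
  \sum_i a i * (-1) ^+ x i.

Definition flip1 (I : finType) (i : I) : {ffun I -> bool} := [ffun j => j == i].

Lemma walsh_flip1 (R : comNzRingType) (I : finType) (S : {set I}) (i : I) :
  walsh R S (flip1 i) = (-1) ^+ (i \in S).
Proof.
rewrite /walsh; case: (boolP (i \in S)) => iS.
  rewrite (bigD1 i) //= ffunE eqxx big1 ?mulr1 // => j /andP[_ /negPf nji].
  by rewrite ffunE nji.
rewrite big1 // => j jS; rewrite ffunE; case: eqVneq => // eji.
by rewrite -eji jS in iS.
Qed.


(* Walsh analysis (Latala and Oleszkiewicz): with
   [G x = (2 - n) h x + sum_i h (x with i flipped)], the triangle inequality
   gives [G >= 0], while the Walsh coefficient of [G] at [S] is [2 - 2 #|S|]
   times that of [h].  Since [h] is even, its coefficients at singletons vanish,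
   and [sum_x h x * G x >= 0] is the claim. *)
Lemma khintchine_sqr (R : realDomainType) (I : finType) (a : I -> R) :
  2 ^+ #|I| * (\sum_x rsum a x ^+ 2) <= 2 * (\sum_x `|rsum a x|) ^+ 2.
Proof.
pose h x := `|rsum a x|; pose n := #|I|.
pose G x := (2 - n%:R) * h x + \sum_i h (flips (flip1 i) x).
have flip1E i x : rsum a (flips (flip1 i) x) = rsum a x - 2 * (a i * (-1) ^+ x i).
  rewrite /rsum (bigD1 i) //= [in RHS](bigD1 i) //= !ffunE eqxx addbT signrN.
  rewrite (eq_bigr (fun j => a j * (-1) ^+ x j)) => [|j /negPf nji];
    first by ring.
  by rewrite !ffunE nji addbF.
have G_ge0 x : 0 <= G x.
  have flip_sum : \sum_i rsum a (flips (flip1 i) x) = (n%:R - 2) * rsum a x.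
    rewrite (eq_bigr _ (fun i _ => flip1E i x)) sumrB sumr_const -mulr_sumr.
    by rewrite mulrBl (mulr_natl _ n) -/(rsum a x).
  have := ler_norm_sum (index_enum I) (fun i => rsum a (flips (flip1 i) x)) xpredT.
  rewrite flip_sum normrM => le_sum.
  rewrite /G -lerBlDl sub0r -mulNr opprB (le_trans _ le_sum) //.
  by rewrite ler_wpM2r ?ler_norm // normr_ge0.
have hatG (S : {set I}) : walsh_coef G S = (2 - 2 * #|S|%:R) * walsh_coef h S.
  transitivity ((2 - n%:R) * walsh_coef h S +
      \sum_i walsh_coef (h \o flips (flip1 i)) S).
    rewrite /walsh_coef mulr_sumr exchange_big -big_split /=.
    by apply: eq_bigr => x _; rewrite mulrDl mulrA mulr_suml.
  rewrite (eq_bigr (fun i => (1 - 2 * (i \in S)%:R) * walsh_coef h S));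
    last first.
    move=> i _; rewrite walsh_coef_flips walsh_flip1; congr (_ * _).
    by case: (i \in S) => /=; ring.
  rewrite -mulr_suml sumrB (sumr_const I) -/n -mulr_sumr -natr_sum.
  rewrite (_ : \sum_i (i \in S) = #|S|)%N; first by ring.
  by rewrite -sum1_card [RHS]big_mkcond; apply: eq_bigr => i _; case: (i \in S).
have hat1 (S : {set I}) : #|S| = 1%N -> walsh_coef h S = 0.
  move=> /eqP/cards1P[i ->]; pose m : {ffun I -> bool} := [ffun=> true].
  have rsumN x : rsum a (flips m x) = - rsum a x.
    rewrite /rsum -sumrN; apply: eq_bigr => j _.
    by rewrite !ffunE addbT signrN mulrN.
  have hN : h \o flips m =1 h by move=> x; rewrite /h /= rsumN normrN.
  have : walsh_coef (h \o flips m) [set i] = walsh_coef h [set i].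
    by apply: eq_bigr => y _; rewrite hN.
  rewrite walsh_coef_flips /walsh big_set1 ffunE expr1 mulN1r => /eqP.
  by rewrite eq_sym -addr_eq0 -mulr2n mulrn_eq0 => /orP[//|/eqP].
have sum_ge0 : 0 <= \sum_(S : {set I}) walsh_coef h S * walsh_coef G S.
  rewrite parseval mulr_ge0 ?exprn_ge0 // sumr_ge0 // => x _.
  by rewrite mulr_ge0 // normr_ge0.
have hat0 : walsh_coef h finset.set0 = \sum_x `|rsum a x|.
  by apply: eq_bigr => x _; rewrite /walsh big_set0 mulr1.
(* By [hatG] the left side is 2 - 2|S| times a square: equality holds at the empty set, both sides
   vanish at singletons by [hat1], and the factor is at most -2 for larger [S]. Summing with
   Parseval gives the claim. *)
have ub (S : {set I}) : walsh_coef h S * walsh_coef G S <=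
    4 * (S == finset.set0)%:R * walsh_coef h finset.set0 ^+ 2 -
    2 * (walsh_coef h S * walsh_coef h S).
  rewrite hatG; case: eqVneq => [->|]; first by rewrite cards0 /=; lra.
  rewrite -card_gt0 leq_eqVlt => /orP[/eqP/esym/hat1 ->|cS].
    by rewrite /=; lra.
  have : 2 <= #|S|%:R :> R by rewrite ler_nat.
  rewrite -subr_ge0 => /mulr_ge0 /(_ (sqr_ge0 (walsh_coef h S))).
  by rewrite /=; lra.
have := le_trans sum_ge0 (ler_sum _ (fun S _ => ub S)).
rewrite sumrB -mulr_sumr parseval (bigD1 finset.set0) //= big1 => [|S /negPf ->].
  rewrite eqxx hat0 addr0 mulr1;
    under eq_bigr do rewrite /h -expr2 real_normK ?num_real //.
  lra.
by rewrite mulr0 mul0r.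
Qed.

Lemma sum_rsum_sqr (R : numDomainType) (I : finType) (a : I -> R) :
  \sum_x rsum a x ^+ 2 = 2 ^+ #|I| * \sum_i a i ^+ 2.
Proof.
have orth (i j : I) : \sum_(x : {ffun I -> bool}) (-1) ^+ x i * (-1) ^+ x j
    = (i == j)%:R * 2 ^+ #|I| :> R.
  have [<-|nij] := eqVneq i j.
    rewrite (eq_bigr (fun=> 1)) => [|x _]; last by rewrite -expr2 sqrr_sign.
    by rewrite mul1r (sumr_const {ffun I -> bool}) card_cube natrX.
  (* Flipping coordinate [i] alone negates every term, so the sum equals its own opposite. *)
  apply/eqP; rewrite mul0r; set s := \sum_x _.
  suff /eqP : s = - s by rewrite -addr_eq0 -mulr2n mulrn_eq0.
  rewrite /s -sumrN -[LHS](sum_flips (flip1 i)); apply: eq_bigr => x _.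
  by rewrite !ffunE eqxx eq_sym (negPf nij) addbT addbF signrN mulNr.
transitivity (\sum_(x : {ffun I -> bool}) \sum_i \sum_j
    a i * a j * ((-1) ^+ x i * (-1) ^+ x j)).
  apply: eq_bigr => x _; rewrite expr2 /rsum big_distrlr /=.
  by apply: eq_bigr => i _; apply: eq_bigr => j _; rewrite mulrACA.
rewrite exchange_big mulr_sumr; apply: eq_bigr => i _ /=.
rewrite exchange_big (bigD1 i) //= -mulr_sumr orth eqxx mul1r big1 => [|j nji].
  by rewrite addr0 mulrC expr2.
by rewrite -mulr_sumr orth eq_sym (negPf nji) mul0r mulr0.
Qed.

Lemma khintchine (R : rcfType) (I : finType) (a : I -> R) :
  2 ^+ #|I| * (Num.sqrt (\sum_i a i ^+ 2) / Num.sqrt 2) <= \sum_x `|rsum a x|.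
Proof.
have := khintchine_sqr a; rewrite sum_rsum_sqr => le_sqr.
have sum_ge0 : 0 <= \sum_i a i ^+ 2 by apply: sumr_ge0 => i _; exact: sqr_ge0.
set lhs := (X in X <= _); have lhs_ge0 : 0 <= lhs.
  by rewrite mulr_ge0 ?exprn_ge0 // divr_ge0 ?sqrtr_ge0.
rewrite -ler_sqr ?nnegrE ?sumr_ge0 // /lhs.
rewrite !exprMn exprVn !sqr_sqrtr // mulrA ler_pdivrMr // [leRHS]mulrC.
by rewrite expr2 -mulrA.
Qed.

(** * Sampling one row of a sign pattern *)

Definition dot (R : nzRingType) (d : nat) (u v : 'rV[R]_d) : R :=
  \sum_i u 0 i * v 0 i.

Definition sign_row (R : nzRingType) (d : nat) (y : {ffun 'I_d -> bool}) :
    'rV[R]_d :=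
  \row_i (-1) ^+ y i.

Definition row_pattern (K d : nat) (w : {ffun 'I_K * 'I_d -> bool}) (k : 'I_K) :
    {ffun 'I_d -> bool} :=
  [ffun i => w (k, i)].

(* The sign pattern of row [k] is uniform and independent of any [g] that ignores
   this row: flipping the signs of row [k] is a bijection that preserves [g]. *)
Lemma resample (R : comNzRingType) (V : Type) (K d : nat) (k : 'I_K)
    (g : {ffun 'I_K * 'I_d -> bool} -> V) (h : V -> {ffun 'I_d -> bool} -> R) :
  (forall w w', (forall j, j != k -> row_pattern w j = row_pattern w' j) ->
    g w = g w') ->
  2 ^+ d * (\sum_w h (g w) (row_pattern w k)) = \sum_w \sum_y h (g w) y.
Proof.
move=> g_row; pose m y : {ffun 'I_K * 'I_d -> bool} :=
  [ffun ki => (ki.1 == k) && y ki.2].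
transitivity (\sum_(y : {ffun 'I_d -> bool}) \sum_w
    h (g w) (flips (row_pattern w k) y)); last first.
  by rewrite exchange_big; apply: eq_bigr => w _; rewrite sum_flips.
rewrite [RHS](eq_bigr (fun=> \sum_w h (g w) (row_pattern w k))) => [|y _].
  by rewrite (sumr_const {ffun 'I_d -> bool}) card_cube card_ord -natrX mulr_natl.
rewrite -[RHS](sum_flips (m y)); apply: eq_bigr => w _; congr (h _ _).
  apply: g_row => j njk; apply/ffunP => i.
  by rewrite !ffunE /= (negPf njk) addbF.
by apply/ffunP => i; rewrite !ffunE /= eqxx addbC.
Qed.

Lemma dot_sign_row (R : nzRingType) (d : nat) (u : 'rV[R]_d) y :
  dot u (sign_row R y) = rsum (u 0) y.
Proof. by apply: eq_bigr => i _; rewrite mxE. Qed.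

(** By [resample], row [k] may be replaced by a fresh uniform sign vector; Khintchine's inequality
    then applies for each [w], with the entries of [g w] as coefficients. *)
Lemma sum_abs_dot_sign (R : realType) (K d : nat) (k : 'I_K)
    (g : {ffun 'I_K * 'I_d -> bool} -> 'rV[R]_d) :
  (forall w w', (forall j, j != k -> row_pattern w j = row_pattern w' j) ->
    g w = g w') ->
  \sum_w enorm (g w) / Num.sqrt 2 <=
    \sum_w `|dot (g w) (sign_row R (row_pattern w k))|.
Proof.
move=> g_row; rewrite -(ler_pM2l (exprn_gt0 d (@ltr0n R 2))).
rewrite (resample (fun u y => `|dot u (sign_row R y)|) g_row) mulr_sumr.
apply: ler_sum => w _; have := khintchine (g w 0); rewrite card_ord.
by move/le_trans; apply; apply: ler_sum => y _; rewrite dot_sign_row.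
Qed.

Lemma enorm_sqr (R : realType) (d : nat) (u : 'rV[R]_d) :
  enorm u ^+ 2 = dot u u.
Proof.
rewrite sqr_sqrtr; last by apply: sumr_ge0 => i _; exact: sqr_ge0.
by apply: eq_bigr => i _; rewrite expr2.
Qed.

Lemma enorm_ge0 (R : realType) (d : nat) (u : 'rV[R]_d) : 0 <= enorm u.
Proof. exact: sqrtr_ge0. Qed.

(** Resampling again, now with the exact second moment of a Rademacher sum. *)
Lemma sum_sqr_dot_sign (R : realType) (K d : nat) (k : 'I_K)
    (g : {ffun 'I_K * 'I_d -> bool} -> 'rV[R]_d) :
  (forall w w', (forall j, j != k -> row_pattern w j = row_pattern w' j) ->
    g w = g w') ->
  \sum_w dot (g w) (sign_row R (row_pattern w k)) ^+ 2 = \sum_w enorm (g w) ^+ 2.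
Proof.
move=> g_row; apply: (@mulfI _ (2 ^+ d)); first by rewrite expf_neq0 ?pnatr_eq0.
rewrite (resample (fun u y => dot u (sign_row R y) ^+ 2) g_row) mulr_sumr.
apply: eq_bigr => w _; under eq_bigr do rewrite dot_sign_row.
by rewrite sum_rsum_sqr card_ord enorm_sqr.
Qed.

(** * Descent of one step *)

Lemma dotDl (R : comNzRingType) (d : nat) (u v w : 'rV[R]_d) :
  dot (u + v) w = dot u w + dot v w.
Proof. by rewrite -big_split; apply: eq_bigr => i _; rewrite mxE mulrDl. Qed.

Lemma dotNl (R : comNzRingType) (d : nat) (u w : 'rV[R]_d) :
  dot (- u) w = - dot u w.
Proof. by rewrite -sumrN; apply: eq_bigr => i _; rewrite mxE mulNr. Qed.

Lemma dotZl (R : comNzRingType) (d : nat) (u w : 'rV[R]_d) (c : R) :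
  dot (c *: u) w = c * dot u w.
Proof. by rewrite mulr_sumr; apply: eq_bigr => i _; rewrite mxE mulrA. Qed.

Lemma dotC (R : comNzRingType) (d : nat) (u v : 'rV[R]_d) : dot u v = dot v u.
Proof. by apply: eq_bigr => i _; rewrite mulrC. Qed.

Lemma dotZr (R : comNzRingType) (d : nat) (u w : 'rV[R]_d) (c : R) :
  dot u (c *: w) = c * dot u w.
Proof. by rewrite dotC dotZl dotC. Qed.

Lemma enormZ (R : realType) (d : nat) (c : R) (u : 'rV[R]_d) :
  enorm (c *: u) = `|c| * enorm u.
Proof.
rewrite /enorm -sqrtr_sqr -sqrtrM ?sqr_ge0 // mulr_sumr; congr Num.sqrt.
by apply: eq_bigr => i _; rewrite mxE exprMn.
Qed.

Lemma dot_le (R : realType) (d : nat) (u v : 'rV[R]_d) :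
  `|dot u v| <= enorm u * enorm v.
Proof.
rewrite -[leRHS]ger0_norm ?mulr_ge0 ?enorm_ge0 // -ler_sqr ?nnegrE ?normr_ge0 //.
rewrite !real_normK ?num_real // exprMn !enorm_sqr -subr_ge0.
(* Cauchy-Schwarz by Lagrange's identity; the factor 2 lets the squares range over all ordered pairs
   (i, j). *)
rewrite -(pmulr_rge0 _ (@ltr0n R 2)).
suff -> : 2 * (dot u u * dot v v - dot u v ^+ 2) =
    \sum_i \sum_j (u 0 i * v 0 j - u 0 j * v 0 i) ^+ 2.
  by apply: sumr_ge0 => i _; apply: sumr_ge0 => j _; exact: sqr_ge0.
have -> : 2 * (dot u u * dot v v - dot u v ^+ 2) =
    dot u u * dot v v + dot v v * dot u u - 2 * (dot u v * dot u v) by ring.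
rewrite /dot !big_distrlr mulr_sumr -big_split -sumrB; apply: eq_bigr => i _ /=.
rewrite mulr_sumr -big_split -sumrB; apply: eq_bigr => j _ /=.
by ring.
Qed.

(** [grad] only records partial derivatives; differentiability makes the directional derivative
    linear in [v], which is then expanded in the canonical basis. *)
Lemma derive_grad (R : realType) (d : nat) (f : 'rV[R]_d -> R) (x v : 'rV[R]_d) :
  differentiable f x -> 'D_v f x = dot (grad f x) v.
Proof.
move=> df; rewrite deriveE // {1}(row_sum_delta v) linear_sum /=.
by apply: eq_bigr => i _; rewrite linearZ /= mxE deriveE // mulrC.
Qed.

Lemma is_derive_line (R : realType) (V : normedModType R) (f : V -> R)
    (x v : V) (t : R) :
  derivable f (x + t *: v) v ->
  is_derive t 1 (fun u => f (x + u *: v)) ('D_v f (x + t *: v)).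
Proof.
pose phi u := f (x + u *: v).
have eq_quot : (fun h : R => h^-1 *: ((phi \o shift t) (h *: 1) - phi t)) =
    (fun h => h^-1 *: ((f \o shift (x + t *: v)) (h *: v) - f (x + t *: v))).
  apply/funext => h; congr (_ *: (_ - _)); rewrite /phi /=; congr f.
  by rewrite -[h *: 1]/(h * 1) mulr1 scalerDl addrCA.
by move=> df; split; rewrite ?/derivable ?/derive eq_quot.
Qed.

(** The mean value theorem is applied to the remainder along the segment minus L/2 |v|^2 t^2: the
    Lipschitz bound makes its derivative nonpositive, which yields the constant L/2 without
    integration. The values 1 and -1 of [c] give the two sides of an absolute value. *)
Lemma taylor1 (R : realType) (d : nat) (f : 'rV[R]_d -> R) (L : R)
    (x v : 'rV[R]_d) (c : R) :
  (forall x, differentiable f x) -> gradient_lipschitz L f -> `|c| <= 1 ->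
  c * (f (x + v) - f x - dot (grad f x) v) <= L / 2 * dot v v.
Proof.
move=> df lip c1.
pose g t := dot (grad f (x + t *: v)) v.
pose phi t : R := c * (f (x + t *: v) - t * g 0) - L / 2 * dot v v * t ^+ 2.
pose dphi t := c * (g t - g 0) - L * dot v v * t.
have is_dphi (t : R) : is_derive t 1 phi (dphi t).
  have := is_derive_line (@diff_derivable _ _ _ _ _ v (df (x + t *: v))).
  rewrite derive_grad // -/(g t) => dg.
  (* Written as a combination of functions, [phi] has a derivative that instance inference can
     compute. *)
  have -> : phi = c *: ((fun u => f (x + u *: v)) - g 0 *: id) -
      (L / 2 * dot v v) *: (id ^+ 2).
    apply/funext => u; rewrite /phi !fctE /= -[g 0 *: u]/(g 0 * u).
    by rewrite -[c *: _]/(c * _) -[_ *: u ^+ 2]/(_ * u ^+ 2) (mulrC u).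
  apply: is_derive_eq; rewrite /dphi /= expr1 /GRing.scale /= !mulr1.
  by field.
have [|t /andP[t_gt0 _]] := MVT ltr01 (fun t _ => is_dphi t).
  by apply: derivable_within_continuous => t _; exact: ex_derive.
rewrite subr0 mulr1 => phi_dphi.
have : dphi t <= 0.
  have g_lip : `|g t - g 0| <= L * t * dot v v.
    rewrite /g scale0r addr0 -dotNl -dotDl (le_trans (dot_le _ _)) //.
    have := lip (x + t *: v) x; rewrite addrAC subrr add0r enormZ gtr0_norm //.
    move=> /(ler_wpM2r (enorm_ge0 v)) /le_trans; apply.
    by rewrite -enorm_sqr expr2 !mulrA.
  rewrite /dphi subr_le0 mulrAC (le_trans (ler_norm _)) // normrM.
  by rewrite (le_trans _ g_lip) // ler_piMl.
rewrite -phi_dphi /phi /g !scale0r !scale1r !addr0 expr1n expr0n /=.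
by lra.
Qed.

Lemma taylor1_abs (R : realType) (d : nat) (f : 'rV[R]_d -> R) (L : R)
    (x v : 'rV[R]_d) :
  (forall x, differentiable f x) -> gradient_lipschitz L f ->
  `|f (x + v) - f x - dot (grad f x) v| <= L / 2 * dot v v.
Proof.
move=> df lip; rewrite ler_norml.
have := @taylor1 R d f L x v 1 df lip; have := @taylor1 R d f L x v (-1) df lip.
rewrite normrN !normr1 lexx => /(_ isT) ? /(_ isT) ?; lra.
Qed.

Definition signs (R : nzRingType) (d : nat) (s : 'rV[R]_d) : Prop :=
  forall i, s 0 i ^+ 2 = 1.

Lemma dot_signs (R : nzRingType) (d : nat) (s : 'rV[R]_d) :
  signs s -> dot s s = d%:R.
Proof.
move=> s1; rewrite /dot (eq_bigr (fun=> 1)) => [|i _]; last by rewrite -expr2.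
by rewrite (sumr_const 'I_d) card_ord.
Qed.

(** The dimension enters here: a sign vector has squared norm [d]. *)
Lemma taylor1_signs (R : realType) (d : nat) (f : 'rV[R]_d -> R) (L c : R)
    (x s : 'rV[R]_d) :
  (forall x, differentiable f x) -> gradient_lipschitz L f -> signs s ->
  `|f (x + c *: s) - f x - c * dot (grad f x) s| <= L * d%:R / 2 * c ^+ 2.
Proof.
move=> df lip s1; have := taylor1_abs x (c *: s) df lip.
by rewrite !dotZr dotZl dot_signs // => /le_trans; apply; lra.
Qed.

(** The new point is no worse than either candidate, so it suffices to apply Taylor's bound to the
    candidate that moves against the sign of the directional derivative. *)
Lemma s2p_descent (R : realType) (d : nat) (f : 'rV[R]_d -> R) (L a : R)
    (s x y : 'rV[R]_d) :
  (forall x, differentiable f x) -> gradient_lipschitz L f ->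
  signs s -> 0 <= a -> s2p_step f a s x y ->
  f y <= f x - a * `|dot (grad f x) s| + L * d%:R / 2 * a ^+ 2.
Proof.
move=> df lip s1 a_ge0 [_ le_p le_m].
have taylor c : f (x + c *: s) <= f x + c * dot (grad f x) s +
    L * d%:R / 2 * c ^+ 2.
  have := taylor1_signs c x df lip s1.
  by rewrite ler_norml => /andP[_]; lra.
have [g_ge0|g_lt0] := leP 0 (dot (grad f x) s).
  by rewrite ger0_norm // (le_trans le_m) // -scaleNr (le_trans (taylor _)) //;
    lra.
by rewrite ltr0_norm // (le_trans le_p) // (le_trans (taylor _)) //; lra.
Qed.

(** In the central difference the values at [x] cancel; two Taylor remainders of at most L d rho^2 /
    2 each are left, divided by 2 rho. *)
Lemma s2p_gamma_error (R : realType) (d : nat) (f : 'rV[R]_d -> R) (L rho : R)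
    (s x : 'rV[R]_d) :
  (forall x, differentiable f x) -> gradient_lipschitz L f ->
  signs s -> 0 < rho ->
  `|s2p_gamma f rho s x - dot (grad f x) s| <= L * d%:R * rho / 2.
Proof.
move=> df lip s1 rho_gt0.
have taylor c := taylor1_signs c x df lip s1.
rewrite -(ler_pM2l (_ : 0 < 2 * rho)) ?mulr_gt0 //.
rewrite -{1}(@gtr0_norm _ (2 * rho)) ?mulr_gt0 // -normrM.
have -> : 2 * rho * (s2p_gamma f rho s x - dot (grad f x) s) =
    (f (x + rho *: s) - f x - rho * dot (grad f x) s) -
    (f (x - rho *: s) - f x - (- rho) * dot (grad f x) s).
  by rewrite /s2p_gamma; field; rewrite gt_eqF.
have := taylor (- rho); rewrite scaleNr => taylorN.
rewrite (le_trans (ler_normB _ _)) // (le_trans (lerD (taylor _) taylorN)) //.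
by lra.
Qed.

(* With [u = <grad f x, s>] and [gamma] its finite-difference estimate, the
   step [|gamma| / (L d)] decreases [f] by
   [(2 |gamma| |u| - gamma^2) / (2 L d) = (u^2 - (|gamma| - |u|)^2) / (2 L d)]. *)
Lemma s2p_descent_dynamic (R : realType) (d : nat) (f : 'rV[R]_d -> R)
    (L rho : R) (s x y : 'rV[R]_d) :
  (forall x, differentiable f x) -> gradient_lipschitz L f ->
  0 < L -> (0 < d)%N -> signs s -> 0 < rho ->
  rho <= Num.sqrt 2 * enorm (grad f x) / (L * d%:R) ->
  s2p_step f (`|s2p_gamma f rho s x| / (L * d%:R)) s x y ->
  f y <= f x - (dot (grad f x) s ^+ 2 - enorm (grad f x) ^+ 2 / 2) /
               (2 * L * d%:R).
Proof.
move=> df lip L_gt0 d_gt0 s1 rho_gt0 rho_le step.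
have dR_gt0 : 0 < d%:R :> R by rewrite ltr0n.
have Ld_gt0 : 0 < L * d%:R by rewrite mulr_gt0.
have := s2p_descent df lip s1 (divr_ge0 (normr_ge0 _) (ltW Ld_gt0)) step.
have := s2p_gamma_error x df lip s1 rho_gt0.
move: (s2p_gamma _ _ _ _) (dot _ s) => gam u err desc.
apply: (le_trans desc).
(* The cap on [rho] is what bounds the estimation error L d rho / 2 by the gradient norm over sqrt
   2. *)
have err2 : (`|gam| - `|u|) ^+ 2 <= enorm (grad f x) ^+ 2 / 2.
  have le_rho : L * d%:R * rho / 2 <= Num.sqrt 2 / 2 * enorm (grad f x).
    by move: rho_le; rewrite ler_pdivlMr //; lra.
  have := le_trans (ler_dist_dist _ _) (le_trans err le_rho).
  rewrite -ler_sqr ?nnegrE ?normr_ge0 ?mulr_ge0 ?divr_ge0 ?sqrtr_ge0 ?enorm_ge0 //.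
  rewrite real_normK ?num_real // !exprMn sqr_sqrtr // exprVn => /le_trans;
    apply.
  lra.
have -> : f x - `|gam| / (L * d%:R) * `|u| +
    L * d%:R / 2 * (`|gam| / (L * d%:R)) ^+ 2 =
  f x - (`|u| ^+ 2 - (`|gam| - `|u|) ^+ 2) / (2 * L * d%:R).
  by field; rewrite !gt_eqF.
rewrite real_normK ?num_real // lerD2l lerN2 ler_pM2r ?lerB ?lerD2l ?lerN2 //.
by rewrite invr_gt0 -mulrA mulr_gt0.
Qed.

(** * Reduction to uniform sign patterns *)

Lemma prod_const_EFin (R : realDomainType) (I : Type) (J : seq I) (c : R) :
  (\prod_(i <- J) c%:E = (c ^+ size J)%:E)%E.
Proof.
elim: J => [|i J IH]; first by rewrite big_nil expr0.
by rewrite big_cons IH -EFinM exprS.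
Qed.

(** For Rademacher signs these events partition the sample space, and whatever is determined by the
    first [K] draws is constant on each of them. *)
Definition sign_cell (disp : measure_display) (T : measurableType disp)
    (R : realType) (P : probability T R) (K d : nat)
    (e : nat * 'I_d -> {RV P >-> R}) (w : {ffun 'I_K * 'I_d -> bool}) : set T :=
  [set t | forall (k : 'I_K) i, e (val k, i) t = (-1) ^+ w (k, i)].

Lemma sign_cellE (disp : measure_display) (T : measurableType disp)
    (R : realType) (P : probability T R) (K d : nat)
    (e : nat * 'I_d -> {RV P >-> R}) (w : {ffun 'I_K * 'I_d -> bool}) :
  exists J (B : nat * 'I_d -> set R),
    [/\ uniq J, size J = (K * d)%N,
        forall ki, exists b : bool, B ki = [set (-1) ^+ b]
      & sign_cell e w = \bigcap_(ki in [set` J]) (e ki @^-1` B ki)].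
Proof.
(* Independence requires a set for every index; the default [false] serves indices with k >= K,
   which do not occur in the list [J]. *)
pose B (ki : nat * 'I_d) : set R :=
  [set (-1) ^+ (if insub ki.1 is Some k then w (k, ki.2) else false)].
exists [seq (val ki.1, ki.2) | ki <- enum {: 'I_K * 'I_d}], B; split.
- rewrite map_inj_uniq ?enum_uniq // => -[k i] [k' i'] /= [/val_inj -> ->] //.
- by rewrite size_map -cardE card_prod !card_ord.
- by move=> ki; rewrite /B; case: insub => [k|];
  [exists (w (k, ki.2)) | exists false].
apply/seteqP; split=> t /= cell_t.
  move=> _ /= /mapP[[k i] _ ->] /=.
  by rewrite /B /= valK; exact: cell_t.
move=> k i; have /= := cell_t (val k, i); rewrite /B /= valK; apply.
by apply/mapP; exists (k, i); rewrite ?mem_enum.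
Qed.

Lemma measurable_sign_cell (disp : measure_display) (T : measurableType disp)
    (R : realType) (P : probability T R) (K d : nat)
    (e : nat * 'I_d -> {RV P >-> R}) (w : {ffun 'I_K * 'I_d -> bool}) :
  measurable (sign_cell e w).
Proof.
have [J [B [_ _ B1 ->]]] := sign_cellE e w.
apply: fin_bigcap_measurable => // ki _.
by have [b ->] := B1 ki; exact: measurable_funPTI.
Qed.

Lemma probability_sign_cell (disp : measure_display) (T : measurableType disp)
    (R : realType) (P : probability T R) (K d : nat)
    (e : nat * 'I_d -> {RV P >-> R}) (w : {ffun 'I_K * 'I_d -> bool}) :
  iid_rademacher e -> P (sign_cell e w) = (2^-1 ^+ (K * d))%:E.
Proof.
move=> [e_rad e_ind]; have [J [B [J_uniq sJ B1 ->]]] := sign_cellE e w.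
rewrite e_ind // => [|ki]; last by have [b ->] := B1 ki.
rewrite -sJ -prod_const_EFin; apply: eq_bigr => ki _.
by have [_ P1 PN1] := e_rad ki; have [[] ->] := B1 ki.
Qed.

Lemma sign_cell_cover (disp : measure_display) (T : measurableType disp)
    (R : realType) (P : probability T R) (K d : nat)
    (e : nat * 'I_d -> {RV P >-> R}) (t : T) :
  iid_rademacher e -> exists w : {ffun 'I_K * 'I_d -> bool}, sign_cell e w t.
Proof.
move=> [e_rad _]; exists [ffun ki => e (val ki.1, ki.2) t == -1] => k i.
rewrite ffunE /=; have [/(_ t) [] -> _ _] := e_rad (val k, i).
  by rewrite -addr_eq0 -mulr2n pnatr_eq0.
by rewrite eqxx.
Qed.

Lemma sign_cell_inj (disp : measure_display) (T : measurableType disp)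
    (R : realType) (P : probability T R) (K d : nat)
    (e : nat * 'I_d -> {RV P >-> R}) (w w' : {ffun 'I_K * 'I_d -> bool}) (t : T) :
  sign_cell e w t -> sign_cell e w' t -> w = w'.
Proof.
move=> cw cw'; apply/ffunP => -[k i].
by apply: (@signr_inj R); rewrite /= -(cw k i).
Qed.

(** [tau] picks a representative of each cell. A function of the first [K] draws is a finite
    combination of cell indicators, hence measurable, and all cells have the same probability. *)
Lemma iid_rademacher_sample (disp : measure_display) (T : measurableType disp)
    (R : realType) (P : probability T R) (K d : nat)
    (e : nat * 'I_d -> {RV P >-> R}) :
  iid_rademacher e ->
  exists2 tau : {ffun 'I_K * 'I_d -> bool} -> T,
    forall w (k : 'I_K), draw e k (tau w) = sign_row R (row_pattern w k)
  & forall h : T -> R,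
      (forall t, 0 <= h t) ->
      (forall t t', (forall j, (j < K)%N -> draw e j t = draw e j t') ->
         h t = h t') ->
      ('E_P[h])%E = (2^-1 ^+ (K * d) * \sum_w h (tau w))%:E.
Proof.
move=> e_iid.
(* A cell has positive probability, hence is nonempty. *)
have inhab (w : {ffun 'I_K * 'I_d -> bool}) : exists t, sign_cell e w t.
  apply/set0P/eqP => cell0; have := probability_sign_cell w e_iid.
  rewrite cell0 measure0 => -[/esym/eqP].
  by rewrite expf_eq0 invr_eq0 pnatr_eq0 andbF.
have [tau tauP] := choice inhab.
exists tau => [w k|h h_ge0 h_draw].
  by apply/rowP => i; rewrite !mxE tauP ffunE.
rewrite unlock.
transitivity (\int[P]_t (\sum_w (h (tau w))%:E * (\1_(sign_cell e w) t)%:E))%E.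
  apply: eq_integral => t _; have [w cw] := sign_cell_cover K t e_iid.
  rewrite (bigD1 w) //= indicE mem_set // mule1 big1 => [|w' nww'].
    rewrite adde0; congr EFin; apply: h_draw => j ltjK; apply/rowP => i.
    by rewrite !mxE (cw (Ordinal ltjK)) (tauP w (Ordinal ltjK)).
  rewrite indicE memNset ?mule0 // => cw'.
  by rewrite (sign_cell_inj cw' cw) eqxx in nww'.
rewrite ge0_integral_sum //=; last 2 first.
- move=> w; apply/measurable_EFinP/measurable_funM => //.
  exact/measurable_indic/measurable_sign_cell.
- by move=> w t _; rewrite mule_ge0 ?lee_fin.
rewrite mulr_sumr -sumEFin; apply: eq_bigr => w _.
rewrite ge0_integralZl ?lee_fin //; last first.
  exact/measurable_EFinP/measurable_indic/measurable_sign_cell.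
rewrite integral_indic ?setIT //; last exact: measurable_sign_cell.
rewrite mulrC EFinM; congr (_ * _)%E; exact: probability_sign_cell.
Qed.

(** * Telescoping *)

Lemma sum_cube_const (R : nzRingType) (K d : nat) (c : R) :
  \sum_(w : {ffun 'I_K * 'I_d -> bool}) c = 2 ^+ (K * d) * c.
Proof.
rewrite (sumr_const {ffun 'I_K * 'I_d -> bool}) card_cube card_prod !card_ord.
by rewrite -natrX mulr_natl.
Qed.

(** Turns expectations into sums over patterns. The iterate [x k] depends only on rows before [k],
    so it ignores row [k], as [resample] demands. *)
Lemma returns_stationaryP (disp : measure_display) (T : measurableType disp)
    (R : realType) (P : probability T R) (K d : nat) (f : 'rV[R]_d -> R)
    (e : nat * 'I_d -> {RV P >-> R}) (x : nat -> T -> 'rV[R]_d) :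
  (0 < K)%N -> iid_rademacher e -> nonanticipating K (draw e) x ->
  exists tau : {ffun 'I_K * 'I_d -> bool} -> T,
    [/\ forall w (k : 'I_K), draw e k (tau w) = sign_row R (row_pattern w k),
        forall (k : 'I_K) w w',
          (forall j, j != k -> row_pattern w j = row_pattern w' j) ->
          x k (tau w) = x k (tau w')
      & forall eps, \sum_(k < K) \sum_w enorm (grad f (x k (tau w))) <=
          2 ^+ (K * d) * K%:R * eps ->
        returns_stationary P f x K eps].
Proof.
move=> K_gt0 e_iid x_na;
  have [tau draw_tau E_tau] := iid_rademacher_sample K e_iid.
exists tau; split=> // [k w w' eq_w|eps le_eps].
  apply: (x_na _ _ _ (ltn_ord k)) => j ltjk.
  pose j' := Ordinal (ltn_trans ltjk (ltn_ord k)).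
  by rewrite (draw_tau w j') (draw_tau w' j') eq_w // neq_ltn ltjk.
rewrite /returns_stationary (eq_bigr (fun k : 'I_K => (2^-1 ^+ (K * d) *
    \sum_w enorm (grad f (x k (tau w))))%:E)) => [|k _]; last first.
  apply: E_tau => [t|t t' eq_t]; first exact: enorm_ge0.
  congr (enorm (grad f _)); apply: (x_na _ _ _ (ltn_ord k)) => j ltjk.
  by apply: eq_t; exact: ltn_trans ltjk (ltn_ord k).
rewrite sumEFin -EFinM lee_fin -mulr_sumr ler_pdivrMl ?ltr0n //.
by rewrite exprVn ler_pdivrMl ?exprn_gt0 // mulrA.
Qed.

Lemma sum_decrease_le (R : numDomainType) (K : nat) (F D : nat -> R) :
  (forall k : 'I_K, F k.+1 <= F k - D k) -> \sum_(k < K) D k <= F 0%N - F K.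
Proof.
move=> dec; rewrite -opprB -(telescope_sumr F (leq0n K)) big_mkord -sumrN.
by apply: ler_sum => k _; rewrite opprB lerBrDl -lerBrDr dec.
Qed.

(** * Stationarity under the two step size options *)

Lemma signs_sign_row (R : nzRingType) (d : nat) y : signs (@sign_row R d y).
Proof. by move=> i; rewrite mxE sqrr_sign. Qed.

(** Telescoping bounds the mean gradient norm by sqrt (2 d / K) times [M], which the hypothesis on
    [K] makes at most [eps]. *)
Lemma option1_stationary (disp : measure_display) (T : measurableType disp)
    (R : realType) (P : probability T R) (K d : nat) (f : 'rV[R]_d -> R)
    (e : nat * 'I_d -> {RV P >-> R}) (x : nat -> T -> 'rV[R]_d)
    (L alpha0 fstar eps : R) (x0 : 'rV[R]_d) :
  0 < L -> 0 < alpha0 -> (0 < d)%N -> objective L fstar f -> 0 < eps ->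
  (0 < K)%N -> iid_rademacher e -> option1_run f x0 alpha0 K (draw e) x ->
  2 * d%:R * ((f x0 - fstar) / alpha0 + L * alpha0 / 2) ^+ 2 <= K%:R * eps ^+ 2 ->
  returns_stationary P f x K eps.
Proof.
move=> L_gt0 a_gt0 d_gt0 [df lip f_ge] eps_gt0 K_gt0 e_iid [x_na x_0 x_step] le_K.
have [tau [draw_tau x_tau]] := returns_stationaryP f K_gt0 e_iid x_na; apply.
set M := (_ / _ + _) in le_K; set r := Num.sqrt (K%:R * d%:R) in x_step.
have dR_gt0 : 0 < d%:R :> R by rewrite ltr0n.
have KR_gt0 : 0 < K%:R :> R by rewrite ltr0n.
have r_gt0 : 0 < r by rewrite sqrtr_gt0 mulr_gt0.
have r2 : r ^+ 2 = K%:R * d%:R by rewrite sqr_sqrtr // ltW // mulr_gt0.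
set N := 2 ^+ (K * d); have N_gt0 : 0 < N by rewrite exprn_gt0.
have s2_gt0 : 0 < Num.sqrt 2 :> R by rewrite sqrtr_gt0.
have s22 : Num.sqrt 2 ^+ 2 = 2 :> R by rewrite sqr_sqrtr.
have a_ge0 : 0 <= alpha0 / r by rewrite ltW // divr_gt0.
set S := \sum_(k < K) _.
have decr (k : 'I_K) : \sum_w f (x k.+1 (tau w)) <= \sum_w f (x k (tau w)) -
    (alpha0 / r * (\sum_w enorm (grad f (x k (tau w))) / Num.sqrt 2) -
     N * (L * d%:R / 2 * (alpha0 / r) ^+ 2)).
  have le_step : \sum_w f (x k.+1 (tau w)) <= \sum_w (f (x k (tau w)) -
      alpha0 / r * `|dot (grad f (x k (tau w))) (sign_row R (row_pattern w k))| +
      L * d%:R / 2 * (alpha0 / r) ^+ 2).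
    apply: ler_sum => w _; rewrite -draw_tau; apply: s2p_descent => //;
      last exact: x_step.
    by rewrite draw_tau; exact: signs_sign_row.
  apply: (le_trans le_step);
    rewrite big_split sumrB -mulr_sumr sum_cube_const -/N /=.
  have := sum_abs_dot_sign (fun w w' eq_w => congr1 (grad f) (x_tau k w w' eq_w)).
  by move=> /(ler_wpM2l a_ge0); lra.
have := sum_decrease_le (F := fun k => \sum_w f (x k (tau w)))
  (D := fun k => alpha0 / r * (\sum_w enorm (grad f (x k (tau w))) / Num.sqrt 2) -
     N * (L * d%:R / 2 * (alpha0 / r) ^+ 2)) decr.
have x_tau0 : \sum_w f (x 0%N (tau w)) = N * f x0.
  by rewrite -sum_cube_const; apply: eq_bigr => w _; rewrite x_0.
have x_tauK : N * fstar <= \sum_w f (x K (tau w)).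
  by rewrite -sum_cube_const; apply: ler_sum.
rewrite x_tau0 sumrB -mulr_sumr (sumr_const 'I_K) card_ord.
under eq_bigr do rewrite -mulr_suml.
rewrite -mulr_suml -/S => tele.
have M_ge0 : 0 <= M.
  rewrite addr_ge0 ?divr_ge0 ?subr_ge0 ?f_ge ?(ltW a_gt0) //.
  by rewrite mulr_ge0 ?ltW.
have S_le : S <= N * (Num.sqrt 2 * r * M).
  (* The squared step size is alpha0^2 / (K d), so the [K] second-order terms add up to a quantity
     independent of [K] and [d], up to the factor [N] counting patterns. *)
  have Kc : N * (L * d%:R / 2 * (alpha0 / r) ^+ 2) *+ K =
      N * (L * alpha0 ^+ 2 / 2).
    rewrite -[LHS]mulr_natl expr_div_n r2; field; rewrite !gt_eqF //.
  have : alpha0 / r * (S / Num.sqrt 2) <= N * (alpha0 * M).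
    have -> : alpha0 * M = f x0 - fstar + L * alpha0 ^+ 2 / 2.
      by rewrite /M; field; rewrite gt_eqF.
    by move: tele; rewrite Kc; lra.
  move=> le_M; rewrite -(ler_pM2l (divr_gt0 a_gt0 (mulr_gt0 r_gt0 s2_gt0))).
  have -> : alpha0 / (r * Num.sqrt 2) * (N * (Num.sqrt 2 * r * M)) = N * (alpha0 * M).
    by field; rewrite !gt_eqF.
  by rewrite invfM mulrA -[_ / _ / _ * S]mulrA [_^-1 * S]mulrC.
apply: (le_trans S_le); rewrite -[leRHS]mulrA ler_pM2l //.
rewrite -ler_sqr ?nnegrE ?mulr_ge0 ?(ltW r_gt0) ?(ltW s2_gt0) ?(ltW eps_gt0) //.
rewrite !exprMn s22 r2.
by have := ler_wpM2l (ltW KR_gt0) le_K; lra.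
Qed.

(* [u <= (u^2 + eps^2) / (2 eps)] turns the bound on the mean of the squared
   gradient norms into one on the mean of the norms. *)
Lemma option2_stationary (disp : measure_display) (T : measurableType disp)
    (R : realType) (P : probability T R) (K d : nat) (f : 'rV[R]_d -> R)
    (e : nat * 'I_d -> {RV P >-> R}) (rho : nat -> T -> R)
    (x : nat -> T -> 'rV[R]_d) (L fstar eps : R) (x0 : 'rV[R]_d) :
  0 < L -> (0 < d)%N -> objective L fstar f -> 0 < eps ->
  (0 < K)%N -> iid_rademacher e -> option2_run f x0 L K (draw e) rho x ->
  4 * L * d%:R * (f x0 - fstar) <= K%:R * eps ^+ 2 ->
  returns_stationary P f x K eps.
Proof.
move=> L_gt0 d_gt0 [df lip f_ge] eps_gt0 K_gt0 e_iid [_ rho_le] [x_na x_0 x_step] le_K.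
have [tau [draw_tau x_tau]] := returns_stationaryP f K_gt0 e_iid x_na; apply.
have dR_gt0 : 0 < d%:R :> R by rewrite ltr0n.
have KR_gt0 : 0 < K%:R :> R by rewrite ltr0n.
have Ld_gt0 : 0 < 4 * L * d%:R by rewrite !mulr_gt0.
set N := 2 ^+ (K * d); have N_gt0 : 0 < N by rewrite exprn_gt0.
have decr (k : 'I_K) : \sum_w f (x k.+1 (tau w)) <= \sum_w f (x k (tau w)) -
    (\sum_w enorm (grad f (x k (tau w))) ^+ 2) / (4 * L * d%:R).
  have le_step : \sum_w f (x k.+1 (tau w)) <= \sum_w (f (x k (tau w)) -
      (dot (grad f (x k (tau w))) (sign_row R (row_pattern w k)) ^+ 2 -
       enorm (grad f (x k (tau w))) ^+ 2 / 2) / (2 * L * d%:R)).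
    apply: ler_sum => w _; rewrite -draw_tau.
    have [rho_gt0 le_rho] := rho_le k (tau w) (ltn_ord k).
    apply: s2p_descent_dynamic le_rho _ => //; last exact: x_step.
    by rewrite draw_tau; exact: signs_sign_row.
  apply: (le_trans le_step); rewrite sumrB -mulr_suml sumrB -mulr_suml.
  (* The mean of the squared directional derivative is the full squared gradient norm; half of it
     pays for the estimation error, and the other half gives the denominator 4 L d. *)
  have -> := sum_sqr_dot_sign (fun w w' eq_w => congr1 (grad f) (x_tau k w w' eq_w)).
  by rewrite le_eqVlt; apply/orP; left; apply/eqP; field; rewrite !gt_eqF.
have := sum_decrease_le (F := fun k => \sum_w f (x k (tau w)))
  (D := fun k => (\sum_w enorm (grad f (x k (tau w))) ^+ 2) / (4 * L * d%:R)) decr.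
have x_tau0 : \sum_w f (x 0%N (tau w)) = N * f x0.
  by rewrite -sum_cube_const; apply: eq_bigr => w _; rewrite x_0.
have x_tauK : N * fstar <= \sum_w f (x K (tau w)).
  by rewrite -sum_cube_const; apply: ler_sum.
rewrite x_tau0 -mulr_suml ler_pdivrMr //;
  set S2 := \sum_(k < K) \sum_w _ ^+ 2 => tele.
have S2_le : S2 <= N * (K%:R * eps ^+ 2).
  apply: le_trans (_ : N * (4 * L * d%:R * (f x0 - fstar)) <= _);
    last by rewrite ler_pM2l.
  by apply: (le_trans tele);
    rewrite [leRHS]mulrCA [leRHS]mulrC ler_pM2r // mulrBr lerB.
have amgm : \sum_(k < K) \sum_w enorm (grad f (x k (tau w))) <=
    (S2 + N * (K%:R * eps ^+ 2)) / (2 * eps).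
  have -> : N * (K%:R * eps ^+ 2) =
      \sum_(k < K) \sum_(w : {ffun 'I_K * 'I_d -> bool}) eps ^+ 2.
    by rewrite sum_cube_const (sumr_const 'I_K) card_ord mulrCA mulr_natl.
  rewrite -big_split mulr_suml; apply: ler_sum => k _ /=.
  rewrite -big_split mulr_suml; apply: ler_sum => w _ /=.
  rewrite ler_pdivlMr ?mulr_gt0 // -subr_ge0.
  by apply: le_trans (sqr_ge0 (enorm (grad f (x k (tau w))) - eps)) _; lra.
apply: (le_trans amgm); rewrite ler_pdivrMr ?mulr_gt0 //.
by move: S2_le; lra.
Qed.

(** * Iteration counts and the complexity bound *)

Lemma natr_above (R : archiRealDomainType) (b : R) :
  0 <= b -> exists K : nat, [/\ (0 < K)%N, b <= K%:R & K%:R <= b + 1].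
Proof.
move=> /truncn_itv /andP[le_b lt_b]; exists (Num.trunc b).+1; split=> //.
  exact: ltW.
by rewrite -natr1 lerD2r.
Qed.

Theorem theorem3p8 (R : realType) (L alpha0 : R)
    (L_gt0 : 0 < L) (alpha0_gt0 : 0 < alpha0) :
  (* sufficient numbers of iterations *)
  (forall (d : nat) (f : 'rV[R]_d -> R) (fstar : R) (x0 : 'rV[R]_d)
      (eps : R) (K : nat) (disp : measure_display) (T : measurableType disp)
      (P : probability T R) (e : nat * 'I_d -> {RV P >-> R})
      (x : nat -> T -> 'rV[R]_d),
    (0 < d)%N -> objective L fstar f -> 0 < eps -> (0 < K)%N ->
    iid_rademacher e ->
    (option1_run f x0 alpha0 K (draw e) x ->
     2 * d%:R / eps ^+ 2 *
       ((f x0 - fstar) / alpha0 + L * alpha0 / 2) ^+ 2 <= K%:R ->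
     returns_stationary P f x K eps)
    /\
    (forall rho : nat -> T -> R,
     option2_run f x0 L K (draw e) rho x ->
     (forall k t, (k < K)%N ->
        rho k t ^+ 2 / 2 < eps ^+ 2
        /\ 4 * L * d%:R * (f x0 - fstar) / (eps ^+ 2 - rho k t ^+ 2 / 2)
             <= K%:R) ->
     returns_stationary P f x K eps))
  /\
  (* O(d / eps^2) function evaluations *)
  (forall Delta : R, exists C : R,
    forall (d : nat) (f : 'rV[R]_d -> R) (fstar : R) (x0 : 'rV[R]_d)
      (eps : R),
    (0 < d)%N -> objective L fstar f -> f x0 - fstar = Delta ->
    0 < eps -> eps <= 1 ->
    (exists K : nat,
       [/\ (0 < K)%N,
           (option1_evaluations K)%:R <= C * (d%:R / eps ^+ 2)
         & forall (disp : measure_display) (T : measurableType disp)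
             (P : probability T R) (e : nat * 'I_d -> {RV P >-> R})
             (x : nat -> T -> 'rV[R]_d),
             iid_rademacher e ->
             option1_run f x0 alpha0 K (draw e) x ->
             returns_stationary P f x K eps])
    /\
    (exists K : nat,
       [/\ (0 < K)%N,
           (option2_evaluations K)%:R <= C * (d%:R / eps ^+ 2)
         & forall (disp : measure_display) (T : measurableType disp)
             (P : probability T R) (e : nat * 'I_d -> {RV P >-> R})
             (rho : nat -> T -> R) (x : nat -> T -> 'rV[R]_d),
             iid_rademacher e ->
             option2_run f x0 L K (draw e) rho x ->
             returns_stationary P f x K eps])).
Proof.
split=> [d f fstar x0 eps K disp T P e x d_gt0 f_obj eps_gt0 K_gt0 e_iid|Delta].
  have eps2_gt0 : 0 < eps ^+ 2 by rewrite exprn_gt0.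
  split=> [run le_K|rho run le_K].
    apply: (option1_stationary L_gt0 alpha0_gt0 d_gt0 f_obj _ _ e_iid run) => //.
    by move: le_K; rewrite mulrAC ler_pdivrMr.
  (* The bound on [K] is quantified over sample points: a representative of some pattern provides
     one, and iteration 0 is used. *)
  have [tau _ _] := iid_rademacher_sample K e_iid.
  have [rho_lt] := le_K 0%N (tau [ffun=> false]) K_gt0.
  rewrite ler_pdivrMr ?subr_gt0 // => {}le_K.
  apply: (option2_stationary L_gt0 d_gt0 f_obj _ _ e_iid run) => //.
  (* Subtracting rho^2 / 2 only shrinks the denominator, so the bound with eps^2 alone follows. *)
  apply: (le_trans le_K); rewrite ler_wpM2l // gerBl.
  by rewrite divr_ge0 ?sqr_ge0.
pose M := Delta / alpha0 + L * alpha0 / 2.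
(* Sum of the constants of the two options: 2 K <= 4 M^2 q + 2 and 4 K <= 16 L Delta q + 4 for q = d
   / eps^2. The absolute value keeps both nonnegative for every [Delta]. *)
exists (4 * M ^+ 2 + 2 + (16 * L * `|Delta| + 4)).
move=> d f fstar x0 eps d_gt0 f_obj Delta_def eps_gt0 eps_le1.
have [_ _ f_ge] := f_obj.
have Delta_ge0 : 0 <= Delta by rewrite -Delta_def subr_ge0.
have dR_ge1 : 1 <= d%:R :> R by rewrite ler1n.
have eps2_gt0 : 0 < eps ^+ 2 by rewrite exprn_gt0.
set q := d%:R / eps ^+ 2.
(* This is where [eps <= 1] enters: it lets the cost of rounding [K] up be absorbed into a multiple
   of [q]. *)
have q_ge1 : 1 <= q.
  by rewrite ler_pdivlMr // mul1r (le_trans _ dR_ge1) // expr_le1 // ltW.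
have q_ge0 : 0 <= q by rewrite (le_trans _ q_ge1).
have M2q_ge0 : 0 <= M ^+ 2 * q by rewrite mulr_ge0 ?sqr_ge0.
have LDq_ge0 : 0 <= L * Delta * q by rewrite mulr_ge0 // mulr_ge0 // ltW.
rewrite (ger0_norm Delta_ge0); split.
  have [K [K_gt0 le_K K_le]] : exists K : nat,
      [/\ (0 < K)%N, 2 * (M ^+ 2 * q) <= K%:R & K%:R <= 2 * (M ^+ 2 * q) + 1].
    by apply: natr_above; rewrite mulr_ge0.
  exists K; split=> // [|disp T P e x e_iid run].
    by rewrite /option1_evaluations natrM; lra.
  apply: (option1_stationary L_gt0 alpha0_gt0 d_gt0 f_obj _ _ e_iid run) => //.
  rewrite Delta_def -/M -ler_pdivrMr //; apply: le_trans le_K.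
  by rewrite /q; lra.
have [K [K_gt0 le_K K_le]] : exists K : nat,
    [/\ (0 < K)%N, 4 * (L * Delta * q) <= K%:R & K%:R <= 4 * (L * Delta * q) + 1].
  by apply: natr_above; rewrite mulr_ge0.
exists K; split=> // [|disp T P e rho x e_iid run].
  by rewrite /option2_evaluations natrM; lra.
apply: (option2_stationary L_gt0 d_gt0 f_obj _ _ e_iid run) => //.
rewrite Delta_def -ler_pdivrMr //; apply: le_trans le_K.
by rewrite /q; lra.
Qed.
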